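(* For each of the two passenger responses (Linear and MinImprov), for every instance of the BRT investment problem $\textsc{BRT}(\star/Z\ge 1/|M|\ge 1)$, the algorithm described in the context (''Algorithm 1'') computes the set of all non-dominated points of the instance; that is, it terminates and the set $\Gamma$ it returns equals the set of all non-dominated points.
   Context: An instance consists of: a linear graph $G=(V,E)$ with $V=\{1,\dots,n\}$, $n\in\mathbb N_{\ge1}$ (stations) and $E=\{e_i=\{i,i+1\}: i\in\{1,\dots,n-1\}\}$ (segments); upgrade costs $c_e\in\mathbb N_{\ge1}$ for $e\in E$; a bound $Z\in\mathbb N_{\ge1}$; a finite set $M$ of municipalities with pairwise disjoint sets $E_m\subseteq E$ of consecutive segments, $\bigcup_{m\in M}E_m=E$; budget shares $b_m\in\mathbb R_{>0}$ with $\sum_{m\in M}b_m=1$; a set of OD pairs $D\subseteq\{(i,j):i,j\in V,i\neq j\}$, where $W_d\subseteq E$ denotes the edge set of the unique path from $i$ to $j$ in $G$ for $d=(i,j)\in D$; numbers of potential passengers $a_d\in\mathbb N_{\ge1}$ for $d\in D$; infrastructure improvements $u_e\in\mathbb R_{>0}$ for $e\in E$; and, for MinImprov, thresholds $L_d\in\mathbb R_{\ge0}$ with $L_d\le\sum_{e\in W_d}u_e$ for $d\in D$. For $F\subseteq E$ the number of newly attracted passengers is $p(F)=\sum_{d\in D}p_d(F)$, where in Linear $p_d(F)=a_d\cdot\frac{\sum_{e\in F\cap W_d}u_e}{\sum_{e\in W_d}u_e}$, and in MinImprov $p_d(F)=a_d$ if $L_d\le\sum_{e\in F\cap W_d}u_e$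 and $p_d(F)=0$ otherwise. BRT components of $F$ are the connected components of the subgraph $G[F]$ consisting of the edges in $F$ and their incident nodes. A pair $(F,v)$ with $F\subseteq E$, $v\in\mathbb R_{\ge0}$ is feasible if $\sum_{e\in F\cap E_m}c_e\le b_m v$ for all $m\in M$ (budget constraints) and $F$ has at most $Z$ BRT components. The BRT investment problem is to maximize $p(F)$ and minimize $v$ over feasible $(F,v)$. A feasible $(F,v)$ is efficient, and $(p(F),v)$ is called non-dominated, if there is no feasible $(F',v')$ with $p(F')\ge p(F)$, $v'\le v$ and at least one inequality strict. The single-objective problem with budget $B$ is: maximize $p(F)$ over all $F\subseteq E$ such that $(F,B)$ is feasible. Algorithm 1. Initialize $\Gamma\gets\emptyset$, $B\gets\max_{m\in M}\{\frac1{b_m}\sum_{e\in E_m}c_e\}$, $v^*\gets\max_{m\in M}\{\frac1{b_m}\sum_{e\in E_m}c_e\}$, $p^*\gets\sum_{d\in D}a_d$. While $B\ge0$ do: (1) solve the single-objective problem with budget $B$; let $F$ be an optimal solution and $\bar p$ the optimal value; (2) $\bar v\gets\max_{m\in M}\{\frac1{b_m}\sum_{e\in F\cap E_m}c_e\}$; (3) $\bar M(\bar v)\gets\{m\in M:\sum_{e\in F\cap E_m}c_e=b_m\bar v\}$; (4) $\delta\gets\min\left\{\min_{m\in\bar M(\bar v)}\frac1{b_m},\ \min_{m\in M\setminus\bar M(\bar v)}\frac{b_m\bar v-\lceil b_m\bar v-1\rceil}{b_m}\right\}$; (5) if $\bar p<p^*$, then $\Gamma\gets\Gamma\cup\{(p^*,v^*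 )\}$ and $p^*\gets\bar p$; (6) $v^*\gets\bar v$; (7) $B\gets\bar v-\delta$. After the loop, $\Gamma\gets\Gamma\cup\{(p^*,v^* )\}$; return $\Gamma$. *)

(* Defs.v *)
From HB Require Import structures.
From Stdlib Require Import Relation_Operators.
From mathcomp Require Import all_boot all_order all_algebra.
From mathcomp Require Import boolp classical_sets reals constructive_ereal.

Set Implicit Arguments.
Unset Strict Implicit.
Unset Printing Implicit Defensive.

Import Order.TTheory GRing.Theory Num.Theory.

Local Open Scope ring_scope.

(** ** The linear graph *)

(* Vertices and edges are numbered from 0: the edge [e : 'I_n.-1] joins the
   vertices [e] and [e.+1] of ['I_n]. *)
Definition ends (n : nat) (e : 'I_n.-1) : {set 'I_n} :=
  [set x : 'I_n | (x == e :> nat) || (x == e.+1 :> nat)].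

Definition adj (n : nat) (F : {set 'I_n.-1}) : rel 'I_n :=
  fun x y => [exists e in F, ends e == [set x; y]].

Definition incident (n : nat) (F : {set 'I_n.-1}) : {set 'I_n} :=
  \bigcup_(e in F) ends e.

Definition num_components (n : nat) (F : {set 'I_n.-1}) : nat :=
  n_comp (adj F) (incident F).

(* As in [path], the vertices of the path are [i :: q]. *)
Definition simple_path (n : nat) (i j : 'I_n) (q : seq 'I_n) : bool :=
  [&& path (adj [set: 'I_n.-1]) i q, uniq (i :: q) & last i q == j].

Definition traverses (n : nat) (i : 'I_n) (q : seq 'I_n) (e : 'I_n.-1) : bool :=
  has (fun xy => ends e == [set xy.1; xy.2]) (pairmap pair i q).

(* The simple path from [d.1] to [d.2] is unique, so this is its edge set. *)
Definition path_edges (n : nat) (d : 'I_n * 'I_n) : {set 'I_n.-1} :=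
  [set e | `[< exists q, simple_path d.1 d.2 q /\ traverses d.1 q e >]].

Definition consecutive (k : nat) (A : {set 'I_k}) : Prop :=
  forall e f g : 'I_k, e \in A -> g \in A -> (e <= f <= g)%N -> f \in A.

(** ** Instances *)

Record instance (R : realType) := Instance {
  stations : nat;
  stations_ge1 : (1 <= stations)%N;
  cost : 'I_stations.-1 -> nat;
  cost_ge1 : forall e, (1 <= cost e)%N;
  maxcomp : nat;
  maxcomp_ge1 : (1 <= maxcomp)%N;
  muni : finType;
  muni_ge1 : (1 <= #|muni|)%N;
  segs : muni -> {set 'I_stations.-1};
  segs_consecutive : forall m, consecutive (segs m);
  segs_disjoint : forall m m', m != m' -> [disjoint segs m & segs m'];
  segs_cover : \bigcup_m segs m = [set: 'I_stations.-1];
  share : muni -> R;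
  share_gt0 : forall m, 0 < share m;
  share_sum : \sum_m share m = 1;
  od : {set 'I_stations * 'I_stations};
  od_neq : forall d, d \in od -> d.1 != d.2;
  passengers : 'I_stations * 'I_stations -> nat;
  passengers_ge1 : forall d, d \in od -> (1 <= passengers d)%N;
  improvement : 'I_stations.-1 -> R;
  improvement_gt0 : forall e, 0 < improvement e
}.

Notation station I := 'I_(stations I).
Notation segment I := 'I_(stations I).-1.

Definition total_improvement (R : realType) (I : instance R)
    (A : {set segment I}) : R :=
  \sum_(e in A) improvement e.

Variant response (R : realType) (I : instance R) :=
| Linear
| MinImprov (L : station I * station I -> R) of
    forall d, d \in od I -> 0 <= L d <= total_improvement (path_edges d).

Definition attracted_od (R : realType) (I : instance R) (r : response I)
    (F : {set segment I}) (d : station I * station I) : R :=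
  match r with
  | Linear => (passengers d)%:R *
      (total_improvement (F :&: path_edges d) /
       total_improvement (path_edges d))
  | MinImprov L _ =>
      if L d <= total_improvement (F :&: path_edges d)
      then (passengers d)%:R else 0
  end.

Definition attracted (R : realType) (I : instance R) (r : response I)
    (F : {set segment I}) : R :=
  \sum_(d in od I) attracted_od r F d.

(** ** Feasibility and non-dominated points *)

Definition spending (R : realType) (I : instance R) (F : {set segment I})
    (m : muni I) : R :=
  (\sum_(e in F :&: segs m) cost e)%:R.

Definition feasible (R : realType) (I : instance R) (F : {set segment I})
    (v : R) : Prop :=
  [/\ 0 <= v,
      forall m, spending F m <= share m * v
    & (num_components F <= maxcomp I)%N].

Definition dominates (R : realType) (I : instance R) (r : response I)
    (F' : {set segment I}) (v' : R) (F : {set segment I}) (v : R) : Prop :=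
  [/\ attracted r F <= attracted r F', v' <= v
    & attracted r F < attracted r F' \/ v' < v].

Definition efficient (R : realType) (I : instance R) (r : response I)
    (F : {set segment I}) (v : R) : Prop :=
  feasible F v /\ ~ exists F' v', feasible F' v' /\ dominates r F' v' F v.

Definition nondominated (R : realType) (I : instance R) (r : response I) :
    set (R * R) :=
  [set z | exists F v, efficient r F v /\ z = (attracted r F, v)]%classic.

(** ** The algorithm *)

Definition optimal (R : realType) (I : instance R) (r : response I) (B : R)
    (F : {set segment I}) : Prop :=
  feasible F B /\ forall F', feasible F' B -> attracted r F' <= attracted r F.

(* The default 0 of the maximum is harmless, since all the terms are
   nonnegative and there is at least one municipality. *)
Definition needed_budget (R : realType) (I : instance R)
    (F : {set segment I}) : R :=
  \big[Num.max/0]_(m : muni I) ((share m)^-1 * spending F m).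

Definition tight (R : realType) (I : instance R) (F : {set segment I})
    (v : R) : {set muni I} :=
  [set m | spending F m == share m * v].

(* Minima over an empty set of municipalities are [+oo]; at most one of the two
   is, since there is at least one municipality, so [fine] loses nothing. *)
Definition decrement (R : realType) (I : instance R) (F : {set segment I})
    (v : R) : R :=
  fine (mine
    (\big[mine/+oo]_(m in tight F v) (share m)^-1%:E)
    (\big[mine/+oo]_(m in ~: tight F v)
       ((share m * v - (Num.ceil (share m * v - 1))%:~R) / share m)%:E))%E.

Record state (R : realType) := State {
  Gamma : set (R * R);
  budget : R;
  vstar : R;
  pstar : R
}.

Definition initial (R : realType) (I : instance R) : state R :=
  State set0 (needed_budget [set: segment I]) (needed_budget [set: segment I])
    (\sum_(d in od I) (passengers d)%:R).

Definition record_point (R : realType) (s : state R) : set (R * R) :=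
  (Gamma s `|` [set (pstar s, vstar s)])%classic.

Definition update (R : realType) (I : instance R) (r : response I)
    (s : state R) (F : {set segment I}) : state R :=
  let pbar := attracted r F in
  let vbar := needed_budget F in
  let delta := decrement F vbar in
  State (if pbar < pstar s then record_point s else Gamma s)
        (vbar - delta)
        vbar
        (if pbar < pstar s then pbar else pstar s).

(* The optimal solution used in an iteration is arbitrary, hence a relation. *)
Definition iteration (R : realType) (I : instance R) (r : response I)
    (s t : state R) : Prop :=
  0 <= budget s /\ exists F, optimal r (budget s) F /\ t = update r s F.

Definition reachable (R : realType) (I : instance R) (r : response I)
    (s : state R) : Prop :=
  clos_refl_trans (state R) (iteration r) (initial I) s.

(* No execution is infinite, and none gets stuck inside the loop for want of
   an optimal solution. *)
Definition terminates (R : realType) (I : instance R) (r : response I) : Prop :=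
  (~ exists s : nat -> state R,
       s 0%N = initial I /\ forall k, iteration r (s k) (s k.+1)) /\
  (forall s, reachable r s -> 0 <= budget s -> exists t, iteration r s t).

Definition returns (R : realType) (I : instance R) (r : response I)
    (G : set (R * R)) : Prop :=
  exists s, [/\ reachable r s, budget s < 0 & G = record_point s].

(* Main.v *)
(* Let [needed_budget F] be the least budget with which the segments in [F] can
   be paid.  Its value is [spending F m / share m] for some [m], with an
   integral numerator, and the decrement is chosen such that no set of segments
   has its needed budget strictly between [v - delta] and [v], where [v] is the
   needed budget of the current solution.  Hence each iteration skips only
   budgets at which nothing new becomes feasible, and strictly shrinks the
   finite collection of affordable sets.  Throughout, [(pstar, vstar)] is a
   point of a feasible solution, [pstar] is the best value for the budget
   [vstar], and [Gamma] consists of the non-dominated points with more than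
   [pstar] passengers. *)
Require Import Defs.
From mathcomp Require Import all_boot all_order all_algebra.
From mathcomp Require Import boolp classical_sets reals constructive_ereal.
From mathcomp Require Import finset.

Set Implicit Arguments.
Unset Strict Implicit.
Unset Printing Implicit Defensive.

Import Order.TTheory GRing.Theory Num.Theory.

Local Open Scope ring_scope.

(** * The linear graph *)

Lemma adj_sym (n : nat) (F : {set 'I_n.-1}) : symmetric (adj F).
Proof. by move=> x y; apply: eq_existsb => e; rewrite setUC. Qed.

Lemma connect_line (n : nat) (x y : 'I_n) :
  connect (adj [set: 'I_n.-1]) x y.
Proof.
have n_gt0 : (0 < n)%N by case: n x {y} => [[]|].
suff from0 z : connect (adj [set: 'I_n.-1]) (Ordinal n_gt0) z.
  apply: connect_trans (from0 y).
  by rewrite (sym_connect_sym (@adj_sym _ _)).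
case: z => k; elim: k => [|k IHk] lt_k.
  by rewrite (bool_irrelevance lt_k n_gt0).
apply: connect_trans (IHk (ltnW lt_k)) (connect1 _).
have lt_e : (k < n.-1)%N by rewrite -ltnS prednK.
apply/existsP; exists (Ordinal lt_e); rewrite inE /=.
by apply/eqP/setP => z; rewrite !inE -!val_eqE.
Qed.

Lemma num_components_set0 (n : nat) : num_components (set0 : {set 'I_n.-1}) = 0%N.
Proof.
rewrite /num_components /incident big_set0 /n_comp_mem; apply: eq_card0 => x.
by rewrite !inE andbF.
Qed.

Lemma num_components_setT (n : nat) :
  (num_components [set: 'I_n.-1] <= 1)%N.
Proof.
rewrite /num_components /n_comp_mem; apply/card_le1_eqP => x y.
rewrite !inE => /andP[/eqP <- _] /andP[/eqP <- _].
by apply/eqP; rewrite root_connect ?connect_line //; apply/sym_connect_sym/adj_sym.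
Qed.

Lemma path_edges_neq0 (n : nat) (d : 'I_n * 'I_n) :
  d.1 != d.2 -> path_edges d != set0.
Proof.
move=> neq; have /connectP[p0 p0P last_p0] := connect_line d.1 d.2.
move: last_p0; case: (shortenP p0P) => p pP p_uniq _ last_p.
case: p pP p_uniq last_p => [|y q] pP p_uniq last_p.
  by rewrite last_p eqxx in neq.
have /existsP[e /andP[_ e_ends]] : adj [set: 'I_n.-1] d.1 y by case/andP: pP.
apply/set0Pn; exists e; rewrite inE; apply/asboolP; exists (y :: q); split.
  by rewrite /simple_path pP p_uniq last_p eqxx.
by rewrite /traverses /= e_ends.
Qed.

(** * Passengers *)

Section Response.
Variables (R : realType) (I : instance R) (r : response I).
Implicit Types (A F : {set segment I}) (d : station I * station I).

Lemma total_improvement_ge0 A : 0 <= total_improvement A.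
Proof. by apply: sumr_ge0 => e _; apply/ltW/improvement_gt0. Qed.

Lemma total_improvement_gt0 A : A != set0 -> 0 < total_improvement A.
Proof.
case/set0Pn => e eA; rewrite /total_improvement (bigD1 e) //=.
by rewrite ltr_pwDl ?improvement_gt0 // sumr_ge0 // => f _; apply/ltW/improvement_gt0.
Qed.

Lemma total_improvementIr F A :
  total_improvement (F :&: A) <= total_improvement A.
Proof.
rewrite {2}/total_improvement (big_setID F) /= setIC lerDl.
by apply: total_improvement_ge0.
Qed.

Lemma attracted_od_itv F d : 0 <= attracted_od r F d <= (passengers d)%:R.
Proof.
case: r => [|L LP] /=; last by case: ifP => _; rewrite ?lexx ler0n.
have [-> | dn0] := eqVneq (path_edges d) set0.
  by rewrite setI0 /total_improvement big_set0 mul0r mulr0 lexx ler0n.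
have W_gt0 := total_improvement_gt0 dn0.
rewrite mulr_ge0 ?divr_ge0 ?total_improvement_ge0 //=.
by rewrite ler_piMr // ler_pdivrMr // mul1r total_improvementIr.
Qed.

Lemma attracted_od_setT d :
  d \in od I -> attracted_od r [set: segment I] d = (passengers d)%:R.
Proof.
move=> dD; case: r => [|L LP] /=; rewrite setTI; last by case/andP: (LP _ dD) => _ ->.
by rewrite divff ?mulr1 // gt_eqF // total_improvement_gt0 // path_edges_neq0 // od_neq.
Qed.

Lemma attracted_ge0 F : 0 <= attracted r F.
Proof. by apply: sumr_ge0 => d _; case/andP: (attracted_od_itv F d). Qed.

Lemma attracted_setT :
  attracted r [set: segment I] = \sum_(d in od I) (passengers d)%:R.
Proof. by apply: eq_bigr => d; apply: attracted_od_setT. Qed.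

Lemma attracted_le_setT F : attracted r F <= attracted r [set: segment I].
Proof.
by rewrite attracted_setT; apply: ler_sum => d _; case/andP: (attracted_od_itv F d).
Qed.

(** * Budgets *)

Lemma feasibleP F v :
  feasible F v <-> (num_components F <= maxcomp I)%N /\ needed_budget F <= v.
Proof.
split=> [[v_ge0 Fv Fc] | [Fc /bigmax_leP[v_ge0 Fv]]]; split=> //.
- by apply/bigmax_leP; split=> // m _; rewrite ler_pdivrMl ?share_gt0.
- by move=> m; rewrite -ler_pdivrMl ?share_gt0 // Fv.
Qed.

Lemma needed_budget_ge0 F : 0 <= needed_budget F.
Proof. exact: bigmax_ge_id. Qed.

Lemma needed_budget_set0 : needed_budget (set0 : {set segment I}) = 0.
Proof.
apply/le_anti; rewrite needed_budget_ge0 andbT; apply/bigmax_leP; split=> // m _.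
by rewrite /spending set0I big_set0 mulr0.
Qed.

Lemma spending_le_needed F m : spending F m <= share m * needed_budget F.
Proof. by rewrite -ler_pdivrMl ?share_gt0 // le_bigmax. Qed.

Definition muni_decrement F v (m : muni I) : R :=
  if m \in tight F v then (share m)^-1
  else (share m * v - (Num.ceil (share m * v - 1))%:~R) / share m.

Lemma muni_decrement_gt0 F v m : 0 < muni_decrement F v m.
Proof.
rewrite /muni_decrement; case: ifP => _; first by rewrite invr_gt0 share_gt0.
rewrite divr_gt0 ?share_gt0 // subr_gt0.
by have := ceilB1_lt (share m * v - 1); rewrite intrB ltrD2r.
Qed.

Lemma decrementP F v :
  0 < decrement F v /\ forall m, decrement F v <= muni_decrement F v m.
Proof.
rewrite /decrement; set X := mine _ _.
have X_gt0 : (0 < X)%E.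
  rewrite lt_min; apply/andP; split; apply: lt_bigmin => [|m mT]; rewrite ?ltry // lte_fin.
    by rewrite invr_gt0 share_gt0.
  have := muni_decrement_gt0 F v m; rewrite /muni_decrement.
  by move: mT; rewrite inE => /negPf ->.
have X_le m : (X <= (muni_decrement F v m)%:E)%E.
  rewrite ge_min /muni_decrement; case: ifP => mT; apply/orP; [left | right].
    exact: (@bigmin_le_cond _ _ _ _ m).
  by apply: (@bigmin_le_cond _ _ _ _ m); rewrite inE mT.
have [m0 _] : exists m : muni I, true.
  by case/card_gt0P: (muni_ge1 I) => m _; exists m.
by case: X X_gt0 X_le => [x| _ /(_ m0)|].
Qed.

(* The spending of [F'] is integral, so that being less than [share m * v] it
   is at most the next smaller integer. *)
Lemma muni_decrement_gap F F' v m :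
  spending F' m < share m * v ->
  (share m)^-1 * spending F' m <= v - muni_decrement F v m.
Proof.
rewrite ler_pdivrMl ?share_gt0 // mulrBr /muni_decrement => lt_v.
have sm_neq0 : share m != 0 by rewrite gt_eqF ?share_gt0.
case: ifP => [|_].
  rewrite inE => /eqP v_eq; rewrite divff // lerBrDr -v_eq.
  by move: lt_v; rewrite -v_eq /spending ltr_nat -addn1 -(ler_nat R) natrD.
rewrite [share m * (_ / _)]mulrC divfK // opprB addrC subrK.
rewrite /spending pmulrn in lt_v *.
by rewrite ler_int -ltzD1 -ltrBlDr ceil_gt_int intrB ltrD2r.
Qed.

Lemma needed_budget_gap F F' v :
  needed_budget F' < v -> needed_budget F' <= v - decrement F v.
Proof.
move=> lt_v; have [_ dec_le] := decrementP F v.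
have le_v m : (share m)^-1 * spending F' m <= v - decrement F v.
  apply: (@le_trans _ _ (v - muni_decrement F v m)); last by rewrite lerB.
  apply: muni_decrement_gap.
  by apply: le_lt_trans (spending_le_needed _ _) _; rewrite ltr_pM2l ?share_gt0.
apply/bigmax_leP; split=> [|m _]; last exact: le_v.
case/card_gt0P: (muni_ge1 I) => m _; apply: le_trans (le_v m).
by rewrite mulr_ge0 ?invr_ge0 ?ler0n // ltW ?share_gt0.
Qed.

(** * The algorithm *)

Lemma optimal_exists B : 0 <= B -> exists F, optimal r B F.
Proof.
move=> B_ge0; pose P F := (num_components F <= maxcomp I)%N && (needed_budget F <= B).
have feasP F : reflect (feasible F B) (P F).
  by apply: (iffP andP) => [/feasibleP | /feasibleP].
have P0 : P set0 by rewrite /P num_components_set0 needed_budget_set0.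
case: (@arg_maxP _ _ _ set0 P (attracted r) P0) => F /feasP FB Fmax.
by exists F; split=> // F' /feasP; apply: Fmax.
Qed.

Record invariant (s : state R) : Prop := Invariant {
  budget_le : budget s <= vstar s;
  witness : exists2 F,
    feasible F (vstar s) & attracted r F = pstar s;
  pstar_max : forall F, feasible F (vstar s) -> attracted r F <= pstar s;
  budget_gap : forall F, feasible F (vstar s) ->
    needed_budget F < vstar s -> feasible F (budget s);
  Gamma_eq : Gamma s = [set z | nondominated r z /\ pstar s < z.1]%classic
}.

Lemma invariant_initial : invariant (initial I).
Proof.
have E_feas : feasible [set: segment I] (needed_budget [set: segment I]).
  apply/feasibleP; split=> //.
  exact: leq_trans (num_components_setT _) (maxcomp_ge1 I).
split=> //=.
- by exists [set: segment I]; rewrite ?attracted_setT.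
- by move=> F _; rewrite -attracted_setT attracted_le_setT.
- apply/seteqP; split=> // z [[F [v [_ ->]]]] /=.
  by rewrite -attracted_setT ltNge attracted_le_setT.
Qed.

Lemma record_pointE s q :
  invariant s -> q < pstar s ->
  (forall F, feasible F (budget s) -> attracted r F <= q) ->
  record_point s = [set z | nondominated r z /\ q < z.1]%classic.
Proof.
move=> [_ [F0 F0_feas F0_p] p_max gap Gamma_s] q_lt q_max.
have not_below F v : feasible F v -> q < attracted r F -> vstar s <= v.
  move=> F_feas q_ltF; rewrite leNgt; apply/negP => v_lt.
  case/feasibleP: (F_feas) => Fc Fv.
  have F_feas' : feasible F (vstar s).
    by apply/feasibleP; split=> //; apply: le_trans Fv (ltW v_lt).
  have := q_max F (gap F F_feas' (le_lt_trans Fv v_lt)).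
  by rewrite leNgt q_ltF.
rewrite /record_point Gamma_s; apply/seteqP; split=> z /=.
  case=> [[zN lt_z] | ->]; first by split=> //; apply: lt_trans lt_z.
  split=> //; exists F0, (vstar s); split; last by rewrite F0_p.
  split=> // -[F [v [F_feas [p_le v_le strict]]]].
  rewrite F0_p in p_le strict.
  have v_ge : vstar s <= v by apply: not_below F_feas _; apply: lt_le_trans p_le.
  have v_eq : v = vstar s by apply/le_anti; rewrite v_le.
  rewrite v_eq ltxx in F_feas strict; case: strict => // p_lt.
  by have := p_max F F_feas; rewrite leNgt p_lt.
case=> -[F [v [[F_feas F_eff] ->]]] /= q_ltF.
have [p_lt|p_le] := ltP (pstar s) (attracted r F).
  by left; split=> //; exists F, v.
right; have v_ge := not_below _ _ F_feas q_ltF.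
have [[p_eq ->//]|] := (pselect (attracted r F = pstar s /\ v = vstar s)).
  by rewrite p_eq.
move=> neq; case: F_eff; exists F0, (vstar s); split=> //; split; rewrite ?F0_p //.
have [p_eq | p_neq] := eqVneq (attracted r F) (pstar s).
  right; rewrite lt_neqAle v_ge andbT; apply/eqP => v_eq.
  by case: neq.
by left; rewrite lt_neqAle p_neq.
Qed.

Lemma invariant_iteration s t : invariant s -> iteration r s t -> invariant t.
Proof.
move=> s_inv [B_ge0 [F [[F_feas F_max] ->]]].
case/feasibleP: (F_feas) => Fc FB.
have [dec_gt0 _] := decrementP F (needed_budget F).
have p_le : attracted r F <= pstar s.
  apply: (pstar_max s_inv); apply/feasibleP; split=> //.
  exact: le_trans FB (budget_le s_inv).
have p_eq : (if attracted r F < pstar s then attracted r F else pstar s)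
    = attracted r F.
  by case: ltP => // p_ge; apply/le_anti; rewrite p_ge p_le.
split; rewrite /= ?p_eq.
- by rewrite gerBl ltW.
- by exists F => //; apply/feasibleP.
- move=> F' /feasibleP[F'c F'v]; apply: F_max; apply/feasibleP; split=> //.
  exact: le_trans F'v FB.
- move=> F' /feasibleP[F'c _] F'v; apply/feasibleP; split=> //.
  exact: needed_budget_gap.
- case: ltP => [p_lt | p_ge]; first exact: record_pointE.
  by rewrite (Gamma_eq s_inv); have -> : pstar s = attracted r F by apply/le_anti/andP.
Qed.

Lemma invariant_reachable s : reachable r s -> invariant s.
Proof.
move=> s_reach; have := invariant_initial.
elim: s_reach => [x y xy x_inv | // | x y z _ IHxy _ IHyz x_inv].
  exact: invariant_iteration xy.
exact/IHyz/IHxy.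
Qed.

Definition affordable (s : state R) : {set {set segment I}} :=
  [set F | needed_budget F <= budget s].

Lemma affordable_iteration s t :
  iteration r s t -> (#|affordable t| < #|affordable s|)%N.
Proof.
move=> [B_ge0 [F [[/feasibleP[_ FB] _] ->]]].
have [dec_gt0 _] := decrementP F (needed_budget F).
have lt_F : needed_budget F - decrement F (needed_budget F) < needed_budget F.
  by rewrite gtrBl.
apply/proper_card/properP; split.
  apply/fintype.subsetP => F'; rewrite !inE /= => F'_le.
  exact: le_trans F'_le (le_trans (ltW lt_F) FB).
by exists F; rewrite inE //= -ltNge.
Qed.

End Response.

Theorem lemma8 (R : realType) (I : instance R) (r : response I) :
  terminates r /\
  (forall G : set (R * R), returns r G -> G = nondominated r).
Proof.
split.
  split=> [[s [_ s_iter]] | s _ B_ge0].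
    have bound k : (#|affordable I (s k)| + k <= #|affordable I (s 0%N)|)%N.
      elim: k => [|k IHk]; first by rewrite addn0.
      apply: leq_trans IHk; rewrite addnS -addSn leq_add2r.
      exact: affordable_iteration (s_iter k).
    have := bound #|affordable I (s 0%N)|.+1.
    by rewrite addnS ltnNge leq_addl.
  have [F F_opt] := optimal_exists r B_ge0.
  by exists (update r s F); split=> //; exists F.
move=> G [s [s_reach B_lt0 ->]].
have s_inv := invariant_reachable s_reach.
rewrite (@record_pointE _ _ _ _ (-1) s_inv).
- apply/seteqP; split=> z; first by case.
  move=> zN; split=> //; case: zN => F [v [_ ->]] /=.
  by apply: lt_le_trans (attracted_ge0 r F); rewrite ltrN10.
- case: (witness s_inv) => F _ <-.
  by apply: lt_le_trans (attracted_ge0 r F); rewrite ltrN10.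
- move=> F [B_ge0 _ _]; by move: B_ge0; rewrite leNgt B_lt0.
Qed.
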